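(* Let $\mu$ be a singular cardinal with cofinality $\kappa$. Then $\mathrm{cf}([\mu]^\kappa, \subseteq) \leq \mathfrak{d}_\mu$.
   Context: Work in ZFC. $\kappa^\mu$ (as a set) denotes the set of functions from $\mu$ to $\kappa$. For $f,g\in\kappa^\mu$, $f$ dominates $g$ if $\{\alpha<\mu \mid f(\alpha)\le g(\alpha)\}$ has size less than $\mu$. A family $\mathcal{D}\subseteq\kappa^\mu$ is a dominating family if for every $f\in\kappa^\mu$ there is $g\in\mathcal{D}$ which dominates $f$. $\mathfrak{d}_\mu$ is the least cardinality of a dominating family $\mathcal{D}\subseteq\kappa^\mu$. $[\mu]^\kappa$ is the set of subsets of $\mu$ of cardinality $\kappa$, and $\mathrm{cf}([\mu]^\kappa,\subseteq)$ is the least cardinality of a set $C\subseteq[\mu]^\kappa$ that is cofinal, i.e. every $x\in[\mu]^\kappa$ is included in some $y\in C$. *)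

(* Defs.v *)
From mathcomp Require Import all_boot all_order.
From mathcomp Require Import boolp classical_sets functions cardinality wochoice.

Set Implicit Arguments.
Unset Strict Implicit.
Unset Printing Implicit Defensive.

Import Order.TTheory.
Local Open Scope order_scope.
Local Open Scope classical_set_scope.
Local Open Scope card_scope.

Notation "A '#<' B" := (~~ (B #<= A)) (at level 79) : card_scope.

(* The cardinal "least size of a member of F" is represented by a chosen member
   of F of least cardinality, and is only to be used up to #<= and #=.  If F is
   empty, it is set0; otherwise see least_cardP below. *)
Definition least_card (T : Type) (F : set (set T)) : set T :=
  xget set0 [set A | F A /\ forall B, F B -> A #<= B].

Lemma least_cardP (T : Type) (F : set (set T)) : F !=set0 ->
  F (least_card F) /\ forall B, F B -> least_card F #<= B.
Proof.
move=> [A0 FA0]; apply: (@xgetPex (set T) set0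
  [set A | F A /\ forall B, F B -> A #<= B]).
(* a maximal set S of choice functions that differ pairwise in every coordinate
   has a coordinate at which it is onto the corresponding member of F *)
have [[t0 _]|noT] := pselect (exists t : T, True); last first.
  exists A0; split=> // B _; suff -> : A0 = set0 by apply: card_ge0.
  by rewrite -subset0 => x; case: noT; exists x.
pose good (S : set (set T -> T)) :=
  (forall f A, S f -> F A -> A (f A)) /\
  (forall f g A, S f -> S g -> F A -> f A = g A -> f = g).
have [|S [[S1 S2] Smax]] := @Zorn_bigcup (set T -> T) good.
- move=> C Cgood Ctot; split=> [f A [X CX Xf]|f g A [X CX Xf] [Y CY Yg]].
    by have [+ _] := Cgood _ CX; apply.
  have [_ gX] := Cgood _ CX; have [_ gY] := Cgood _ CY.
  by case: (Ctot _ _ CX CY) => XY; [apply: gY|apply: gX] => //; apply: XY.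
have [A FA Aonto] : exists2 A, F A & forall a, A a -> exists2 f, S f & f A = a.
  apply: contrapT => noA.
  have ex (A : set T) : exists a, F A -> A a /\ forall f, S f -> f A <> a.
    apply: contrapT => noa; apply: noA.
    have FA : F A by apply: contrapT => nF; apply: noa; exists t0.
    exists A => // a Aa; apply: contrapT => nof; apply: noa; exists a => _.
    by split=> // f Sf fAa; apply: nof; exists f.
  have [h hP] := choice ex.
  have nSh : ~ S h by move=> Sh; have [_ nh] := hP _ FA0; exact: (nh h Sh).
  apply: (Smax (S `|` [set h])).
    split; first by move=> f Sf; left.
    by move=> sub; apply: nSh; exact: (sub h (or_intror erefl)).
  split=> [f B [Sf|->] FB|f g B [Sf|->] [Sg|->] FB //].
  - exact: (S1 f B).
  - by have [] := hP _ FB.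
  - exact: (S2 f g B).
  - by have [_ nh] := hP _ FB; move=> /(nh _ Sf).
  - by have [_ nh] := hP _ FB; move=> /esym/(nh _ Sg).
exists A; split=> // B FB.
have onto : forall a, exists f, A a -> S f /\ f A = a.
  move=> a; have [Aa|nAa] := pselect (A a); last by exists (fun=> t0).
  by have [f Sf fa] := Aonto a Aa; exists f.
have [k kP] := choice onto.
have inj : {in A &, injective (fun a => k a B)}.
  move=> a b /set_mem Aa /set_mem Ab /= eqk.
  have [[Sa <-] [Sb <-]] := (kP a Aa, kP b Ab).
  by rewrite (S2 _ _ _ Sa Sb FB eqk).
rewrite -(card_le_eql (inj_card_eq inj)); apply: subset_card_le => _ [a Aa <-].
exact: S1 (kP a Aa).1 FB.
Qed.

(* A cardinal is an initial ordinal; ordinals are represented by well-ordered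
   types, the ordinals below alpha being the elements of the type. *)
Definition is_cardinal (d : Order.disp_t) (alpha : orderType d) : Prop :=
  well_order (<=%O : rel alpha) /\
  forall x : alpha, [set y | y < x] #< [set: alpha].

Definition cofinal (T : Type) (P : set T) (R : T -> T -> Prop) (C : set T) :=
  C `<=` P /\ forall x, P x -> exists2 y, C y & R x y.

Definition cf (T : Type) (P : set T) (R : T -> T -> Prop) : set T :=
  least_card [set C | cofinal P R C].

Definition cof (d : Order.disp_t) (alpha : orderType d) : set alpha :=
  cf [set: alpha] (fun x y => x <= y).
Arguments cof {d} alpha.

Definition is_singular_cardinal (d : Order.disp_t) (mu : orderType d) : Prop :=
  [/\ is_cardinal mu, infinite_set [set: mu] & cof mu #< [set: mu]].

Definition subsets_of_card (mu kappa : Type) : set (set mu) :=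
  [set x | x #= [set: kappa]].
Arguments subsets_of_card : clear implicits.

Section Domination.
Context (mu : Type) (d : Order.disp_t) (kappa : orderType d).

(* f (strictly) dominates g, so it is f that is the larger function. *)
Definition dominates (f g : mu -> kappa) : Prop :=
  [set a | f a <= g a] #< [set: mu].

Definition dominating_family (D : set (mu -> kappa)) : Prop :=
  forall f, exists2 g, D g & dominates g f.

Definition dominating_number : set (mu -> kappa) :=
  least_card dominating_family.

End Domination.
Arguments dominating_number mu {d} kappa.

(* Main.v *)
Require Import Defs.
From mathcomp Require Import all_boot all_order.
From mathcomp Require Import boolp classical_sets functions cardinality wochoice.

(** Every function g from mu to kappa is turned into a set Y g of kappa many
    points of mu, in such a way that for each x of size kappa some function phi
    satisfies x `<=` Y g as soon as g dominates phi.  The images of a dominating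
    family under Y are then cofinal, and there are no more of them than members
    of the family.

    The link between points of mu and functions into kappa is a system
    f : mu -> option mu -> kappa such that on every set of kappa many points q,
    some f q s takes values unbounded in kappa (unbounded_system).  Its
    coordinates s are the initial segments of mu, including mu itself.  If Q has
    size kappa, the first segment that contains kappa many points of Q has
    cofinality kappa; sending a point of it to the index of a later element of a
    cofinal kappa-sequence is then unbounded on Q, because kappa is regular
    (unbounded_on_thin, cof_regular).

    Let x be enumerated as e i for i in kappa, and let a in mu code a pair (i, s),
    each pair having mu many codes.  Put phi a = f (e i) s.  If g dominates phi,
    then g a <= f q s holds, for q = e i, at fewer than mu many codes a of pairs
    with first component i, and hence at no more of them than there are points
    below some c in a fixed cofinal set of size kappa.  So x is covered by the
    sets V g i c of all q with this property.  Each of these has fewer than kappa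
    elements: otherwise f q s is unbounded in kappa on kappa many of its points q,
    for some s; every code a of (i, s) then satisfies g a <= f q s for one of these
    q; and mu is at most the product of kappa and the segment below c, both of
    which are smaller than mu.

    The bounds on unions and products rest on the equality of an infinite cardinal
    with its square (card_square).  Both this and the reduction of a set of size
    less than mu or kappa to an initial segment use one fact about well-orders
    (card_le_segment). *)

Set Implicit Arguments.
Unset Strict Implicit.
Import Order.TTheory.
Local Open Scope order_scope.
Local Open Scope classical_set_scope.
Local Open Scope card_scope.

(** * Comparison of cardinals *)

Lemma card_le_injP (T U : Type) (A : set T) (B : set U) (f : T -> U) :
  (forall x, A x -> B (f x)) -> {in A &, injective f} -> A #<= B.
Proof.
move=> fAB finj; rewrite -(card_le_eql (inj_card_eq finj)).
by apply: subset_card_le => _ [x Ax <-]; exact: fAB.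
Qed.

Lemma card_le_surj (T U : Type) (A : set T) (B : set U) (f : U -> T) :
  A `<=` f @` B -> A #<= B.
Proof. by move=> AfB; exact: card_le_trans (subset_card_le AfB) (card_image_le _ _). Qed.

Lemma card_le_exinj (T U : Type) (A : set T) (B : set U) (u0 : U) : A #<= B ->
  exists f : T -> U, (forall x, A x -> B (f x)) /\ {in A &, injective f}.
Proof.
move=> /card_leP[f].
pose g x := if pselect (A x) is left Ax then val (f (SigSub (mem_set Ax))) else u0.
have gE x (Ax : x \in A) : g x = val (f (SigSub Ax)).
  rewrite /g; case: pselect => [Ax'|nA]; last by have := set_mem Ax.
  by rewrite (bool_irrelevance (mem_set Ax') Ax).
exists g; split=> [x /mem_set Ax|x y Ax Ay]; rewrite ?gE //.
  exact: set_mem (valP _).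
by move=> /val_inj /inj; rewrite !inE => /(_ I I) /(congr1 val).
Qed.

(** A left inverse of an injection; it lets unions and products be compared by
    images, without managing injectivity. *)
Lemma card_le_exsurj (T U : Type) (A : set T) (B : set U) (t0 : T) : A #<= B ->
  exists f : U -> T, A `<=` f @` B.
Proof.
move=> leAB; have [[x Ax]|nA] := pselect (A !=set0); last first.
  by exists (fun=> t0) => x Ax; case: nA; exists x.
have [u0 _] : exists u : U, True.
  apply: contrapT => noU; have /card_le0P A0 : A #<= @set0 U.
    by apply: card_le_trans leAB _; apply: subset_card_le => u; case: noU; exists u.
  by rewrite A0 in Ax.
have [f [fAB finj]] := card_le_exinj u0 leAB.
have ex u : exists t, forall a, A a -> f a = u -> t = a.
  have [[b Ab fb]|nb] := pselect ((f @` A) u); last first.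
    by exists t0 => a Aa fa; case: nb; exists a.
  by exists b => a Aa fa; apply: finj; rewrite ?inE ?fb.
have [g gP] := choice ex.
by exists g => a Aa; exists (f a); [exact: fAB|exact: gP].
Qed.

(** A family of two sets in a disjoint sum has a member of least cardinality. *)
Lemma card_le_total (T U : Type) (A : set T) (B : set U) :
  A #<= B \/ B #<= A.
Proof.
pose F : set (set (T + U)) := [set inl @` A; inr @` B].
have eA : @inl T U @` A #= A by apply: inj_card_eq => x y _ _ [].
have eB : @inr T U @` B #= B by apply: inj_card_eq => x y _ _ [].
have [[->|->] lF] := @least_cardP _ F (ex_intro _ _ (or_introl erefl)).
  by left; have := lF _ (or_intror erefl); rewrite (card_le_eql eA) (card_le_eqr eB).
by right; have := lF _ (or_introl erefl); rewrite (card_le_eqr eA) (card_le_eql eB).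
Qed.

Lemma card_ltW (T U : Type) (A : set T) (B : set U) : A #< B -> A #<= B.
Proof. by move=> /negP nBA; case: (card_le_total A B). Qed.

Lemma card_le_lt_trans (T U V : Type) (A : set T) (B : set U) (C : set V) :
  A #<= B -> B #< C -> A #< C.
Proof. by move=> AB; apply: contra => CA; exact: card_le_trans AB. Qed.

Lemma card_leX (T T' U U' : Type) (A : set T) (A' : set T') (B : set U) (B' : set U') :
  A #<= A' -> B #<= B' -> A `*` B #<= A' `*` B'.
Proof.
move=> AA' BB'; have [[[x y] [Ax By]]|nAB] := pselect (A `*` B !=set0); last first.
  by have -> : A `*` B = set0; [apply/eqP/negPn/negP => /set0P|exact: card_ge0].
have [f fA] := card_le_exsurj x AA'; have [g gB] := card_le_exsurj y BB'.
apply: (@card_le_surj _ _ _ _ (fun p => (f p.1, g p.2))) => -[a b] [/= Aa Bb].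
by have [a' ? <-] := fA _ Aa; have [b' ? <-] := gB _ Bb; exists (a', b').
Qed.

Lemma card_le_bigcup (I T U : Type) (Z : set I) (A : I -> set T) (B : set U) :
  (forall z, Z z -> A z #<= B) -> \bigcup_(z in Z) A z #<= Z `*` B.
Proof.
move=> AB; have [[x _]|nU] := pselect ((\bigcup_(z in Z) A z) !=set0); last first.
  by rewrite (_ : \bigcup_(z in Z) A z = set0);
    [exact: card_ge0|apply/eqP/negPn/negP => /set0P].
have ex z : exists g : U -> T, Z z -> A z `<=` g @` B.
  have [Zz|nZ] := pselect (Z z); last by exists (fun=> x).
  by have [g] := card_le_exsurj x (AB _ Zz); exists g.
have [g gP] := choice ex.
apply: (@card_le_surj _ _ _ _ (fun p => g p.1 p.2)) => y [z Zz].
by move=> /(gP _ Zz)[u Bu <-]; exists (z, u).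
Qed.

Lemma card_leU1 (T : Type) (A : set T) (x : T) :
  infinite_set A -> A `|` [set x] #<= A.
Proof.
move=> /infiniteP /(card_le_exinj x)[f [fA finj]].
have fI m n : f m = f n -> m = n by apply: finj; rewrite inE.
have [Ax|nAx] := pselect (A x).
  by apply: subset_card_le => y [//|->].
(* Hilbert's hotel: x takes the place of f 0, and f n that of f n.+1 *)
have ex y : exists z, [/\ y = x -> z = f 0%N, forall n, y = f n -> z = f n.+1 &
    y <> x -> ~ range f y -> z = y].
  have [->|yx] := pselect (y = x).
    by exists (f 0%N); split=> // n xfn; case: nAx; rewrite xfn; exact: fA.
  have [[n _ <-]|nfy] := pselect (range f y); last first.
    by exists y; split=> // n yfn; case: nfy; exists n.
  exists (f n.+1); split=> [fnx|m /fI -> //|_ []]; last by exists n.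
  by case: nAx; rewrite -fnx; exact: fA.
have [g gP] := choice ex.
have gx : g x = f 0%N by case: (gP x) => + _ _; apply.
have gf n : g (f n) = f n.+1 by case: (gP (f n)) => _ + _; apply.
have gN y : y <> x -> ~ range f y -> g y = y by case: (gP y).
have cases y : (A `|` [set x]) y ->
    [\/ y = x, range f y | [/\ y <> x, ~ range f y & A y]].
  move=> yAx; have [->|yx] := pselect (y = x); first exact: Or31.
  have [?|?] := pselect (range f y); first exact: Or32.
  by apply: Or33; split=> //; case: yAx.
apply: (@card_le_injP _ _ _ _ g) => [y /cases[->|[n _ <-]|[? ? ?]]|y z].
- by rewrite gx; exact: fA.
- by rewrite gf; exact: fA.
- by rewrite gN.
rewrite !inE => /cases cy /cases cz; case: cy => [->|[n _ <-]|[yx nfy _]];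
  case: cz => [->|[m _ <-]|[zx nfz _]]; rewrite ?gx ?gf ?(gN y) ?(gN z) //.
- by move=> /fI.
- by move=> zf; case: nfz; exists 0%N.
- by move=> /fI.
- by move=> /fI [->].
- by move=> zf; case: nfz; exists n.+1.
- by move=> zf; case: nfy; exists 0%N.
- by move=> zf; case: nfy; exists m.+1.
Qed.

Lemma card_ltU1 (T U : Type) (A : set T) (x : T) (K : set U) :
  infinite_set K -> A #< K -> A `|` [set x] #< K.
Proof.
move=> Kinf AK; have [Afin|Ainf] := pselect (finite_set A); last first.
  exact: card_le_lt_trans (card_leU1 x Ainf) AK.
apply/negP => /card_le_finite KA; apply/Kinf/KA.
by rewrite finite_setU; split=> //; exact: finite_set1.
Qed.

(** * Well-orders and infinite squares *)

Definition trichotomous (T : Type) (lt : T -> T -> Prop) :=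
  forall x y, x <> y -> lt x y \/ lt y x.

(** Well-founded recursion sends each w to an element of B that is not the
    image of a predecessor of w in W.  If such an element always exists, this
    embeds W in B; where it first fails to exist, the predecessors of w have
    already exhausted B.  This replaces the comparison of order types. *)
Lemma card_le_segment (T U : Type) (lt : T -> T -> Prop) (W : set T) (B : set U) :
  well_founded lt -> trichotomous lt -> ~~ (W #<= B) ->
  exists2 w, W w & B #<= W `&` [set y | lt y w].
Proof.
move=> wf conn /negP nWB.
have [[b0 Bb0]|nB] := pselect (B !=set0); last first.
  have [[w Ww]|nW] := pselect (W !=set0).
    exists w => //; suff -> : B = set0 by exact: card_ge0.
    by apply/eqP/negPn/negP => /set0P.
  case: nWB; suff -> : W = set0 by exact: card_ge0.
  by apply/eqP/negPn/negP => /set0P.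
pose fresh w (rec : forall y, lt y w -> U) : set U :=
  [set u | B u /\ forall y (h : lt y w), W y -> rec y h <> u].
pose step w rec : U := @xget {classic U} b0 (@fresh w rec).
(* r w is unspecified when nothing fresh remains; that case is split off below *)
pose r := Fix wf (fun=> U) step.
have rE w : r w = step w (fun y _ => r y).
  rewrite /r Fix_eq // => x f g fg; congr step.
  by apply: functional_extensionality_dep => y; apply: functional_extensionality_dep.
have [[w [Ww nfr]]|allfr] :=
    pselect (exists w, W w /\ ~ (@fresh w (fun y _ => r y) !=set0)).
  exists w => //; apply: (@card_le_surj _ _ _ _ r) => b Bb.
  apply: contrapT => nb; apply: nfr; exists b; split=> // y yw Wy ryb.
  by apply: nb; exists y.
have rP w : W w -> B (r w) /\ forall y, lt y w -> W y -> r y <> r w.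
  move=> Ww; have [u fu] : @fresh w (fun y _ => r y) !=set0.
    by apply: contrapT => nfr; apply: allfr; exists w.
  have := @xgetPex {classic U} b0 _ (ex_intro _ u fu).
  by rewrite [r w]rE => -[].
case: nWB; apply: (@card_le_injP _ _ _ _ r) => [x /rP[]//|x y].
rewrite !inE => Wx Wy rxy; apply: contrapT => /conn[xy|yx].
  by case: (rP y Wy) => _ /(_ x xy Wx).
by case: (rP x Wx) => _ /(_ y yx Wy); exact.
Qed.

Lemma wf_lex (T A : Type) (f : T -> A) (ltA : A -> A -> Prop) (lt : T -> T -> Prop) :
  well_founded ltA -> well_founded lt ->
  well_founded (fun x y => ltA (f x) (f y) \/ f x = f y /\ lt x y).
Proof.
move=> wfA wf x; move ea: (f x) => a; elim: a / (wfA a) x ea => a _ IHa x.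
elim: x / (wf x) => x _ IHx fxa; apply: Acc_intro => y [yx|[fyx yx]].
  by apply: (IHa (f y)) => //; rewrite -fxa.
by apply: IHx => //; rewrite fyx.
Qed.

Lemma well_order_min (T : Type) (R : rel T) (A : set T) : well_order R ->
  A !=set0 -> exists2 z, A z & forall y, A y -> R z y.
Proof.
move=> wo [x Ax]; have [|z [[zA zmin] _]] := wo (fun y => `[< A y >]).
  by exists x; exact/asboolP.
exists z; first exact/asboolP.
by move=> y Ay; apply: zmin; exact/asboolP.
Qed.

Lemma well_order_wf (T : Type) (R : rel T) : well_order R ->
  well_founded (fun x y => ~~ R y x).
Proof.
move=> wo x; apply: contrapT => nx.
have [z nz zmin] := well_order_min wo (ex_intro [set y | ~ Acc _ y] x nx).
apply: nz; apply: Acc_intro => y /negP nRzy.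
by apply: contrapT => /zmin.
Qed.

Lemma well_order_trichotomous (T : Type) (R : rel T) : well_order R ->
  trichotomous (fun x y => ~~ R y x).
Proof.
move=> wo x y xy; apply: contrapT => /not_orP[/negP/negPn Ryx /negP/negPn Rxy].
have Rr u : R u u.
  have [v -> ] := well_order_min wo (ex_intro [set v | v = u] u erefl).
  by apply.
have [|z [_ zU]] := wo (fun z => `[< z = x \/ z = y >]).
  by exists x; apply/asboolP; left.
have zx : z = x.
  by apply: zU; split; [apply/asboolP; left|move=> u /asboolP[->|->]].
have zy : z = y.
  by apply: zU; split; [apply/asboolP; right|move=> u /asboolP[->|->]].
by apply: xy; rewrite -zx.
Qed.

Section Square.
Context (T : Type) (lt : T -> T -> Prop)
  (wf : well_founded lt) (conn : trichotomous lt).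

Let asym x y : lt x y -> ~ lt y x.
Proof. by elim: x / (wf x) y => x _ IH y xy yx; exact: (IH y yx x yx xy). Qed.

Let trans x y z : lt x y -> lt y z -> lt x z.
Proof.
move=> xy yz; apply: contrapT => nxz.
have [zx|xz] := pselect (x = z); first by subst z; exact: asym xy yz.
have zx : lt z x by case: (conn xz).
elim: x / (wf x) y z xy yz zx {nxz xz} => x _ IH y z xy yz zx.
exact: (IH z zx x y).
Qed.

Let max (p : T * T) := if pselect (lt p.1 p.2) then p.2 else p.1.

Let le_max (p : T * T) x : ~ lt x (max p) -> ~ lt x p.1 /\ ~ lt x p.2.
Proof.
rewrite /max; case: pselect => [p12|np12] /= nx; split=> // xp.
  by apply: nx; exact: trans p12.
have [p12|p12] := pselect (p.1 = p.2); first by apply: nx; rewrite p12.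
by case: (conn p12) => // p21; apply: nx; exact: trans p21.
Qed.

(** Comparing maxima first confines the predecessors of q to the square of the
    points that do not exceed max q. *)
Let goedel p q := lt (max p) (max q) \/ max p = max q /\
  (lt p.1 q.1 \/ p.1 = q.1 /\ lt p.2 q.2).

Let goedel_wf : well_founded goedel.
Proof.
apply: (@wf_lex _ _ max lt _ wf); apply: (@wf_lex _ _ fst lt _ wf).
move=> p; move e: p.2 => b; elim: b / (wf b) p e => b _ IH p e.
by apply: Acc_intro => q qp; apply: (IH q.2) => //; rewrite -e.
Qed.

Let goedel_conn : trichotomous goedel.
Proof.
move=> p q pq; rewrite /goedel.
have [m|/conn[]] := pselect (max p = max q); [|by left; left|by right; left].
have [e|/conn[]] := pselect (p.1 = q.1);
  [|by left; right; split=> //; left|by right; right; split=> //; left].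
have [e'|/conn[]] := pselect (p.2 = q.2);
  [|by left; right; split=> //; right|by right; right; split=> //; right].
by case: pq; rewrite (surjective_pairing p) e e' -surjective_pairing.
Qed.

(** If A embedded no copy of its square, then in Goedel's order some segment of
    the square would be at least as large as A.  Such a segment lies in the
    square of a bounded, hence smaller, part of A. *)
Lemma card_square_segment (A : set T) : infinite_set A ->
  (forall a, A a -> A `&` [set y | lt y a] #< A) ->
  (forall B : set T, infinite_set B -> B #< A -> B `*` B #<= B) ->
  A `*` A #<= A.
Proof.
move=> Ainf Aseg IH; apply: contrapT => /negP.
move=> /(card_le_segment goedel_wf goedel_conn)[p [Ap1 Ap2] Aseq].
have Am : A (max p) by rewrite /max; case: pselect.
pose B := (A `&` [set y | lt y (max p)]) `|` [set max p].
have BA : B #< A by apply: card_ltU1 => //; exact: Aseg.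
have AB : A #<= B `*` B.
  apply: card_le_trans Aseq _; apply: subset_card_le => q [[Aq1 Aq2] qp].
  have : ~ lt (max p) (max q).
    case: qp => [qp|[-> _]]; first exact: asym.
    by move=> pp; exact: (asym pp pp).
  move=> /le_max[nq1 nq2]; split; rewrite /B /=.
    have [->|/conn[]//] := pselect (q.1 = max p); first by right.
    by left.
  have [->|/conn[]//] := pselect (q.2 = max p); first by right.
  by left.
have [Bfin|Binf] := pselect (finite_set B).
  by apply: Ainf; apply: card_le_finite AB _; exact: finite_setX.
by apply: (negP BA); exact: card_le_trans AB (IH _ Binf BA).
Qed.
End Square.

(** Among the subsets of T that violate the claim, one has least cardinality.
    Cutting it at its first initial segment of full cardinality makes all the
    remaining initial segments smaller, as the Goedel argument requires. *)
Lemma card_square (T : Type) (A : set T) : infinite_set A -> A `*` A #<= A.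
Proof.
pose F : set (set T) := [set A | infinite_set A /\ ~ (A `*` A #<= A)].
move=> Ainf; apply: contrapT => nA.
have [[Linf nL] Lmin] := @least_cardP T F (ex_intro _ A (conj Ainf nA)).
move: (least_card F) Linf nL Lmin => L Linf nL Lmin.
have [R wo] := well_ordering_principle {classic T}.
have wf := well_order_wf wo; have conn := well_order_trichotomous wo.
pose seg a : set T := L `&` [set y | ~~ R a y].
have [A' [A'L LA' A'seg]] : exists A', [/\ A' `<=` L, L #<= A' &
    forall a, A' a -> A' `&` [set y | ~~ R a y] #< L].
  have [ex|nex] := pselect ([set a | L #<= seg a] !=set0); last first.
    exists L; split=> // a La; apply/negP => LA.
    by apply: nex; exists a.
  have [a La amin] := well_order_min wo ex.
  exists (seg a); split=> [y []//|//|b [Lb nRab]].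
  apply/negP => /card_le_trans Lb'; move/negP: nRab; apply; apply: amin.
  by apply: Lb'; apply: subset_card_le => y [[]].
have A'inf : infinite_set A' by move=> /(card_le_finite LA').
apply: nL; apply: card_le_trans (card_leX LA' LA') _.
apply: card_le_trans (subset_card_le A'L).
apply: (card_square_segment wf conn A'inf) => [a A'a|B Binf BA'].
  by apply/negP => /(card_le_trans LA'); exact/negP/A'seg.
apply: contrapT => nB; move/negP: BA'; apply.
exact: card_le_trans (subset_card_le A'L) (Lmin B (conj Binf nB)).
Qed.

Lemma card_ltX (T U V : Type) (A : set T) (B : set U) (K : set V) :
  infinite_set K -> A #< K -> B #< K -> A `*` B #< K.
Proof.
move=> Kinf.
have aux (T' U' : Type) (A' : set T') (B' : set U') :
    A' #<= B' -> B' #< K -> A' `*` B' #< K.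
  move=> A'B' B'K; apply/negP => KAB.
  have [Bfin|Binf] := pselect (finite_set B').
    apply: Kinf; apply: card_le_finite KAB _; apply: finite_setX => //.
    exact: card_le_finite A'B' Bfin.
  move/negP: B'K; apply; apply: card_le_trans KAB _.
  exact: card_le_trans (card_leX A'B' (card_lexx _)) (card_square Binf).
case: (card_le_total A B) => AB AK BK; first exact: aux.
apply: card_le_lt_trans (aux _ _ _ _ AB AK).
apply: (@card_le_surj _ _ _ _ (fun p => (p.2, p.1))) => -[a b] [/= Aa Bb].
by exists (b, a).
Qed.

Lemma card_eqW (T U : Type) (A : set T) (B : set U) : A #= B -> A #<= B.
Proof. by rewrite card_eq_le => /andP[]. Qed.

Lemma card_lt_segment (d : Order.disp_t) (alpha : orderType d) (T : Type)
    (A : set T) : is_cardinal alpha -> A #< [set: alpha] ->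
  exists x : alpha, A #<= [set y | y < x].
Proof.
move=> [wo _] /(card_le_segment (well_order_wf wo) (well_order_trichotomous wo)).
move=> [x _ Ax]; exists x; apply: card_le_trans Ax _.
by apply: subset_card_le => y [_]; rewrite /= ltNge.
Qed.

Lemma finite_set_max (d : Order.disp_t) (T : orderType d) (A : set T) :
  finite_set A -> A !=set0 -> exists2 m, A m & forall a, A a -> a <= m.
Proof.
move=> /finite_seqP[s ->]; elim: s => [[x]//|b s IH] _.
have [[x xs]|ns] := pselect ([set` s] !=set0); last first.
  exists b; first exact: mem_head.
  by move=> a; rewrite /= inE => /predU1P[-> //|sa]; case: ns; exists a.
have [m ms mmax] := IH (ex_intro _ x xs).
have [bm|/ltW mb] := leP b m.
  by exists m => [|a]; rewrite /= inE; [rewrite ms orbT|case/predU1P=> [->//|/mmax]].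
exists b => [|a]; rewrite /= inE ?eqxx // => /predU1P[->//|/mmax am].
exact: le_trans am mb.
Qed.

(** * The cofinality of mu *)

Section Cofinality.
Context (dmu dkappa : Order.disp_t) (mu : orderType dmu) (kappa : orderType dkappa).
Context (mu_singular : is_singular_cardinal mu) (kappa_cardinal : is_cardinal kappa)
  (kappa_cof : [set: kappa] #= cof mu).

Lemma cof_cofinal (x : mu) : exists2 c, cof mu c & x <= c.
Proof.
have [[_ /(_ x I)]] := @least_cardP _ [set C | cofinal [set: mu] (fun x y => x <= y) C]
  (ex_intro _ setT (conj (fun _ H => H) (fun x _ => ex_intro2 _ _ x I (lexx x)))).
by move=> [c Cc xc] _; exists c.
Qed.

Lemma cof_least (C : set mu) : (forall x, exists2 c, C c & x <= c) -> cof mu #<= C.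
Proof.
move=> Ccof; have [_] := @least_cardP _ [set C | cofinal [set: mu] (fun x y => x <= y) C]
  (ex_intro _ setT (conj (fun _ H => H) (fun x _ => ex_intro2 _ _ x I (lexx x)))).
by apply; split=> // x _; exact: Ccof.
Qed.

(** A finite cofinal set would give mu a greatest element m, and then mu would
    have the cardinality of the segment below m. *)
Lemma cof_infinite : infinite_set [set: kappa].
Proof.
have [[_ mu_card] mu_inf _] := mu_singular.
move=> kfin; have Cfin : finite_set (cof mu) by rewrite -(eq_finite_set kappa_cof).
have [x _] := infinite_setN0 mu_inf.
have [c Cc _] := cof_cofinal x.
have [m _ mmax] := finite_set_max Cfin (ex_intro _ c Cc).
have le_m y : y <= m by have [b Cb yb] := cof_cofinal y; exact: le_trans (mmax b Cb).
suff : [set y | y < m] `|` [set m] #< [set: mu].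
  move/negP; apply; apply: subset_card_le => y _ /=.
  by have := le_m y; rewrite le_eqVlt => /orP[/eqP ->|?]; [right|left].
exact: card_ltU1.
Qed.

(** Let b enumerate a least cofinal subset of mu.  The values of b before z are
    too few to be cofinal in mu, so they have a strict upper bound c z.  The
    function max (c z) (b z) then bounds every b j with j <= z, so it would turn
    a small unbounded set of indices z into a small cofinal subset of mu. *)
Lemma cof_regular (Z : set kappa) : Z #< [set: kappa] ->
  exists i, forall z, Z z -> z < i.
Proof.
move=> Zk; apply: contrapT => Zunb.
have [x0 _] : exists x : mu, True.
  by have [_ /infinite_setN0[x _] _] := mu_singular; exists x.
have [b bC] := card_le_exsurj x0 (card_eqW (card_esym kappa_cof)).
have /choice[c cP] (z : kappa) : exists c, forall j, j < z -> b j < c.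
  apply: contrapT => nc; have /negP := kappa_cardinal.2 z; apply.
  apply: card_le_trans (card_eqW kappa_cof) _.
  apply: card_le_trans (card_image_le b _); apply: cof_least => x.
  apply: contrapT => nx; apply: nc; exists x => j jz; rewrite ltNge; apply/negP => xj.
  by apply: nx; exists (b j) => //; exists j.
move/negP: Zk; apply; apply: card_le_trans (card_eqW kappa_cof) _.
apply: card_le_trans (card_image_le (fun z => Order.max (c z) (b z)) _).
apply: cof_least => x; have [_ /bC[j _ <-] xj] := cof_cofinal x.
have [z Zz jz] : exists2 z, Z z & j <= z.
  apply: contrapT => nz; apply: Zunb; exists j => z Zz.
  by rewrite ltNge; apply/negP => jz; apply: nz; exists z.
exists (Order.max (c z) (b z)); first by exists z.
apply: le_trans xj _; rewrite le_max; move: jz.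
rewrite le_eqVlt => /orP[/eqP ->|/cP/ltW ->//].
by rewrite lexx orbT.
Qed.

Lemma card_lt_bigcup_cof (I T : Type) (Z : set I) (A : I -> set T) :
  Z #< [set: kappa] -> (forall z, Z z -> A z #< [set: kappa]) ->
  \bigcup_(z in Z) A z #< [set: kappa].
Proof.
move=> Zk Ak.
have [k0 _] := infinite_setN0 cof_infinite.
have /choice[i iP] (z : I) : exists i : kappa, Z z -> A z #<= [set j | j < i].
  have [Zz|nZ] := pselect (Z z); last by exists k0.
  by have [i] := card_lt_segment kappa_cardinal (Ak z Zz); exists i.
have [m mP] : exists m, forall z, (i @` Z) z -> z < m.
  by apply: cof_regular; exact: card_le_lt_trans (card_image_le i Z) Zk.
apply: card_le_lt_trans (card_ltX cof_infinite Zk (kappa_cardinal.2 m)).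
apply: card_le_bigcup => z Zz; apply: card_le_trans (iP z Zz) _.
by apply: subset_card_le => j /= /lt_trans; apply; apply: mP; exists z.
Qed.

(** * Functions unbounded on sets of size kappa *)

(** When J is an initial segment, a set Q as below exists only if J has
    cofinality kappa.  An injection c of kappa into one such set is then cofinal
    in J, and h q is an index j with q <= c j.  If h is bounded by i on Q, then Q
    is the union over j < i of its parts up to c j, and regularity makes it
    smaller than kappa. *)
Lemma unbounded_on_thin (J : set mu) : exists h : mu -> kappa, forall Q,
  Q `<=` J -> [set: kappa] #<= Q ->
  (forall x, J x -> Q `&` [set y | y < x] #< [set: kappa]) ->
  forall i, exists2 q, Q q & i <= h q.
Proof.
have [k0 _] := infinite_setN0 cof_infinite.
have [[Q0 [Q0J Q0k Q0thin]]|nQ0] := pselect (exists Q0,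
  [/\ Q0 `<=` J, [set: kappa] #<= Q0 &
  forall x, J x -> Q0 `&` [set y | y < x] #< [set: kappa]]); last first.
  by exists (fun=> k0) => Q QJ Qk Qthin; case: nQ0; exists Q.
have [x0 _] : exists x, Q0 x.
  by apply: infinite_setN0 => Qfin; exact: cof_infinite (card_le_finite Q0k Qfin).
have [c [cQ0 cinj]] := card_le_exinj x0 Q0k.
have /choice[h hP] (q : mu) : exists j, J q -> q <= c j.
  have [Jq|nJ] := pselect (J q); last by exists k0.
  apply: contrapT => nj; move/negP: (Q0thin q Jq); apply.
  apply: (@card_le_injP _ _ _ _ c) => // j _; split; first exact: cQ0.
  by rewrite /= ltNge; apply/negP => qj; apply: nj; exists j.
exists h => Q QJ Qk Qthin i; apply: contrapT => hlt.
suff : \bigcup_(j in [set j | j < i]) (Q `&` [set y | y <= c j]) #< [set: kappa].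
  move/negP; apply; apply: card_le_trans Qk _; apply: subset_card_le => q Qq.
  exists (h q); last by split=> //; exact: hP (QJ _ Qq).
  by rewrite /= ltNge; apply/negP => iq; apply: hlt; exists q.
apply: card_lt_bigcup_cof => [|j _]; first exact: kappa_cardinal.2.
apply: card_le_lt_trans (card_ltU1 (c j) cof_infinite (Qthin _ (Q0J _ (cQ0 j I)))).
apply: subset_card_le => y [Qy] /=; rewrite le_eqVlt => /orP[/eqP ->|?].
  by right.
by left.
Qed.

(** The index s is a point of mu, standing for the segment below it, or None,
    standing for all of mu.  The first of these segments that contains kappa
    many points of Q meets Q in a set with small proper initial parts. *)
Lemma unbounded_system : exists f : mu -> option mu -> kappa, forall Q,
  [set: kappa] #<= Q -> exists s, forall i, exists2 q, Q q & i <= f q s.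
Proof.
pose J (s : option mu) := if s is Some x then [set y | y < x] else setT.
have /choice[h hP] := fun s => unbounded_on_thin (J s).
exists (fun q s => h s q) => Q Qk.
have [ex|nex] :=
    pselect ([set x | [set: kappa] #<= Q `&` [set y | y < x]] !=set0); last first.
  exists None => i; apply: hP => // x _; apply/negP => kx.
  by apply: nex; exists x.
have [[wo _] _ _] := mu_singular.
have [x kx xmin] := well_order_min wo ex.
exists (Some x) => i.
have [q|||q [Qq _] iq] := hP (Some x) (Q `&` [set y | y < x]) _ _ _ i; last by exists q.
- by case.
- exact: kx.
- move=> y yx; apply/negP => ky; suff : x <= y by rewrite leNgt yx.
  apply: xmin; apply: card_le_trans ky _.
  by apply: subset_card_le => z [[]].
Qed.

(** With mu codes for each pair, the fewer than mu places at which domination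
    may fail cannot exhaust the codes of any pair. *)
Lemma fibres_of_size_mu : exists pi : mu -> kappa * option mu, forall p,
  [set: mu] #<= [set a | pi a = p].
Proof.
have [_ mu_inf kmu] := mu_singular.
have [x0 _] := infinite_setN0 mu_inf.
have [k0 _] := infinite_setN0 cof_infinite.
have le_mu : [set: (kappa * option mu) * mu] #<= [set: mu].
  have option_mu : [set: option mu] #<= [set: mu].
    rewrite -(card_le_eqr card_some).
    apply: card_le_trans (card_leU1 None _).
      by apply: subset_card_le => -[x|] _; [left; exists x|right].
    by move/(card_le_finite (card_eqW (card_esym card_some))).
  have kappa_mu : [set: kappa] #<= [set: mu].
    exact: card_le_trans (card_eqW kappa_cof) (card_leT _).
  have sq := card_square mu_inf.
  rewrite -setXTT.
  apply: (card_le_trans (card_leX _ (card_lexx _)) sq).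
  by rewrite -setXTT; exact: card_le_trans (card_leX kappa_mu option_mu) sq.
have [g gP] := card_le_exsurj ((k0, None), x0) le_mu.
exists (fst \o g) => p; apply: (@card_le_surj _ _ _ _ (snd \o g)) => b _.
by have [a _ ga] := gP (p, b) I; exists a; rewrite /= ga.
Qed.

(** * Covering families from dominating families *)

(** The least cardinality is attained because the family of all functions is
    dominating: kappa has no greatest element. *)
Lemma dominating_numberP : dominating_family (dominating_number mu kappa).
Proof.
have [_ mu_inf _] := mu_singular.
apply: (@least_cardP _ (@dominating_family mu _ kappa) _).1.
exists setT => f.
have /choice[g gP] (a : mu) : exists i, f a < i.
  have [|i iP] := @cof_regular [set f a].
    by apply/negP => /card_le_finite /(_ (finite_set1 _)); exact: cof_infinite.
  by exists i; exact: iP.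
exists g => //; rewrite /dominates (_ : [set a | _] = set0).
  by apply/negP => /card_le_finite /(_ (finite_set0 _)).
by apply/eqP/negPn/negP => /set0P[a /=]; rewrite leNgt gP.
Qed.

End Cofinality.

Theorem theorem2 (dmu dkappa : Order.disp_t)
    (mu : orderType dmu) (kappa : orderType dkappa)
    (mu_singular : is_singular_cardinal mu)
    (kappa_cardinal : is_cardinal kappa)
    (kappa_cof : [set: kappa] #= cof mu) :
  cf (subsets_of_card mu kappa) (fun x y => x `<=` y) #<=
    dominating_number mu kappa.
Proof.
have [mu_cardinal mu_inf kmu] := mu_singular.
have kappa_inf := cof_infinite mu_singular kappa_cof.
have [k0 _] := infinite_setN0 kappa_inf.
have [x0 _] := infinite_setN0 mu_inf.
have [f fP] := unbounded_system mu_singular kappa_cardinal kappa_cof.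
have [pi piP] := fibres_of_size_mu mu_singular kappa_cof.
have kappa_mu : [set: kappa] #< [set: mu].
  exact: card_le_lt_trans (card_eqW kappa_cof) kmu.
(* the segment below c bounds the number of places where g fails to exceed f q *)
pose V (g : mu -> kappa) (i : kappa) (c : mu) : set mu :=
  [set q | [set a | (pi a).1 = i /\ g a <= f q (pi a).2] #<= [set y | y < c]].
have V_small g i c : V g i c #< [set: kappa].
  apply/negP => kV; have [e [eV einj]] := card_le_exinj x0 kV.
  have eimg : [set: kappa] #<= range e by rewrite (card_le_eqr (inj_card_eq einj)).
  have [s sP] := fP _ eimg.
  (* q with g a <= f q s exists for every a in the fibre of (i, s), so kappa many
     sets no larger than the segment below c cover a set of size mu *)
  suff : [set: mu] #<= range e `*` [set y | y < c].
    apply/negP; apply: card_ltX => //; last exact: mu_cardinal.2.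
    exact: card_le_lt_trans (card_image_le _ _) kappa_mu.
  apply: card_le_trans (piP (i, s)) _.
  apply: card_le_trans (_ : _ #<= \bigcup_(q in range e)
      [set a | (pi a).1 = i /\ g a <= f q (pi a).2]) _.
    apply: subset_card_le => a /= pia; have [q eq gq] := sP (g a).
    by exists q => //=; rewrite pia.
  by apply: card_le_bigcup => _ [j _ <-]; exact: (eV j I).
(* adding the points of cof mu gives Y g at least kappa many elements *)
pose Y g := \bigcup_(p in setT `*` cof mu) (V g p.1 p.2 `|` [set p.2]).
have Y_card g : Y g #= [set: kappa].
  rewrite card_eq_le; apply/andP; split; last first.
    apply: card_le_trans (card_eqW kappa_cof) _; apply: subset_card_le => c Cc.
    by exists (k0, c) => //; right.
  have sq := card_square kappa_inf.
  apply: card_le_trans (card_le_trans (card_leX sq (card_lexx _)) sq).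
  apply: card_le_trans (card_le_bigcup (B := [set: kappa]) _) _.
    by move=> p _; apply: card_ltW; apply: card_ltU1 => //; exact: kappa_inf.
  apply: card_leX => //; apply: card_leX => //.
  exact: card_eqW (card_esym kappa_cof).
have Ycof : cofinal (subsets_of_card mu kappa) (fun x y => x `<=` y)
    (Y @` dominating_number mu kappa).
  split=> [_ [g _ <-]|x xk]; first exact: Y_card.
  (* e enumerates x; the function to dominate reads f at the points e i *)
  have [e ex] := card_le_exsurj x0 (card_eqW xk).
  have [g Dg gdom] :=
    dominating_numberP mu_singular kappa_cardinal kappa_cof
      (fun a => f (e (pi a).1) (pi a).2).
  exists (Y g); first by exists g.
  have [z Bz] := card_lt_segment mu_cardinal gdom.
  have [c Cc zc] := cof_cofinal z.
  move=> _ /ex[i _ <-]; exists (i, c) => //; left.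
  apply: card_le_trans (card_le_trans _ Bz) _; apply: subset_card_le.
    by move=> a [/= <-].
  by move=> y /= yz; exact: lt_le_trans zc.
have [_ least] := least_cardP (ex_intro _ _ Ycof).
exact: card_le_trans (least _ Ycof) (card_image_le _ _).
Qed.
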